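(* Let $n = m\lambda$ with $m,\lambda$ positive integers, and let $d$ be a positive integer. Then \[ \frac{n!}{(\lambda!)^m\, V_\lambda(n,d-1)} \leq M_\lambda(n,d) \leq \frac{n!}{(\lambda!)^m\, V_\lambda\left(n, \left\lfloor \frac{d-1}{2} \right\rfloor\right)}. \]
   Context: For $n=m\lambda$ (positive integers), a $\lambda$-permutation of length $n$ is an arrangement (sequence of length $n$) of the multiset consisting of $m$ distinct symbols, each repeated exactly $\lambda$ times. The distance between two $\lambda$-permutations is the Hamming distance, i.e. the number of positions in which they disagree. A frequency permutation array $FPA_\lambda(n,d)$ is a set $T$ of $\lambda$-permutations of length $n$ (on a common set of $m=n/\lambda$ symbols) such that any two distinct members of $T$ have distance at least $d$; its size is $|T|$. $M_\lambda(n,d)$ denotes the maximum size of an $FPA_\lambda(n,d)$. For a $\lambda$-permutation $\sigma$ of length $n$, the sphere with centre $\sigma$ and radius $r$ is the set of all $\lambda$-permutations (on the same symbols) with distance at most $r$ from $\sigma$; its cardinality does not depend on $\sigma$ and is denoted $V_\lambda(n,r)$. *)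

(* Defs.v *)
From mathcomp Require Import all_boot all_fingroup.

Set Implicit Arguments.
Unset Strict Implicit.
Unset Printing Implicit Defensive.

(* The m symbols are the elements of 'I_m and the length is n = m * lam. *)
Definition word (m lam : nat) := (m * lam).-tuple 'I_m.

Definition lperms (m lam : nat) : {set word m lam} :=
  [set s : word m lam | [forall a : 'I_m, count_mem a s == lam]].

Definition hamming (T : eqType) (n : nat) (s t : n.-tuple T) : nat :=
  #|[set i : 'I_n | tnth s i != tnth t i]|.

Definition is_FPA (m lam d : nat) (T : {set word m lam}) : bool :=
  (T \subset lperms m lam) &&
  [forall s in T, forall t in T, (s != t) ==> (d <= hamming s t)].

(* M_lam(m * lam, d) *)
Definition maxFPA (m lam d : nat) : nat :=
  \max_(T : {set word m lam} | is_FPA d T) #|T|.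

Definition sphere (m lam r : nat) (s : word m lam) : {set word m lam} :=
  [set t in lperms m lam | hamming s t <= r].

Lemma base_subproof (m lam : nat) (i : 'I_(m * lam)) : i %/ lam < m.
Proof.
case: lam i => [|l] i; last by rewrite ltn_divLR.
by case: i => i; rewrite muln0.
Qed.

(* 0 ... 0 1 ... 1 ... m-1 ... m-1, each symbol repeated lam times *)
Definition base (m lam : nat) : word m lam :=
  [tuple Ordinal (base_subproof i) | i < m * lam].

(* V_lam(m * lam, r); base is an arbitrary choice of centre, see card_sphere. *)
Definition sphere_size (m lam r : nat) : nat := #|sphere r (base m lam)|.

Lemma base_lperm (m lam : nat) : base m lam \in lperms m lam.
Proof.
rewrite inE; apply/forallP => a; apply/eqP.
have -> : count_mem a (base m lam) =
    count (fun i : nat => i %/ lam == a) (iota 0 (m * lam)).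
  by rewrite -val_enum_ord /= !count_map; apply: eq_count => i /=.
have lam0 : lam = 0 \/ 0 < lam by case: lam; [left|right].
case: lam0 => [->|lam0]; first by rewrite muln0.
have -> : m * lam = a * lam + (lam + (m - a.+1) * lam).
  by rewrite addnA -mulSnr -mulnDl subnKC.
rewrite !iotaD !count_cat add0n.
rewrite (_ : count _ (iota 0 _) = 0) ?add0n; last first.
  apply/eqP; rewrite -leqn0 leqNgt -has_count; apply/hasPn => i.
  rewrite mem_iota /= add0n => lti; apply: contraTneq lti => <-.
  by rewrite -leqNgt leq_divM.
rewrite (_ : count _ (iota (_ + _) _) = 0) ?addn0; last first.
  apply/eqP; rewrite -leqn0 leqNgt -has_count; apply/hasPn => i.
  rewrite mem_iota -mulSnr => /andP[lei _].
  by rewrite gtn_eqF // leq_divRL.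
rewrite -[RHS](size_iota (a * lam) lam).
apply/eqP; rewrite -all_count; apply/allP => i.
rewrite mem_iota -mulSnr => /andP[le1 lt1].
by rewrite eqn_leq leq_divRL // le1 andbT -ltnS ltn_divLR.
Qed.

Lemma card_sphere (m lam r : nat) (s : word m lam) :
  s \in lperms m lam -> #|sphere r s| = sphere_size m lam r.
Proof.
suff le_sphere (u v : word m lam) : u \in lperms m lam -> v \in lperms m lam ->
    #|sphere r u| <= #|sphere r v|.
  by move=> ls; apply/eqP; rewrite eqn_leq !le_sphere ?base_lperm.
move=> lu lv.
have /tuple_permP[p def_v] : perm_eq v u.
  apply/allP => a _ /=; move: lu lv; rewrite !inE.
  by move=> /forallP/(_ a)/eqP-> /forallP/(_ a)/eqP->.
pose f (t : word m lam) : word m lam := [tuple tnth t (p i) | i < m * lam].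
have inj_f : injective f.
  move=> t1 t2 eq_f; apply: eq_from_tnth => i.
  by move/(congr1 (fun t => tnth t ((p^-1)%g i))): eq_f; rewrite !tnth_mktuple permKV.
have {}def_v : v = f u by apply: val_inj.
rewrite -(card_imset _ inj_f); apply/subset_leq_card/subsetP => _ /imsetP[t + ->].
rewrite !inE => /andP[/forallP lt dt]; apply/andP; split.
  apply/forallP => a; apply/eqP.
  transitivity (count_mem a t); last exact/eqP/lt.
  apply/seq.permP.
  by apply/tuple_permP; exists p.
apply: leq_trans dt; rewrite def_v /hamming.
rewrite -(card_imset [set i | tnth (f u) i != tnth (f t) i] (@perm_inj _ p)).
apply/subset_leq_card/subsetP => _ /imsetP[i + ->].
by rewrite !inE !tnth_mktuple.
Qed.

(* Main.v *)
Require Import Defs.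
From mathcomp Require Import all_boot all_order all_algebra.

Set Implicit Arguments.
Unset Strict Implicit.
Unset Printing Implicit Defensive.

Import Order.TTheory GRing.Theory Num.Theory.
Local Open Scope ring_scope.

(** Spheres of radius d - 1 around a largest code cover the space (a word
    outside of all of them could be added to the code), and spheres of radius
    (d - 1)/2 around the words of any code are disjoint. The space has
    n! / (lambda!)^m elements, by induction on n: deleting the first letter [a]
    of a word with letter counts [c] turns the product of the [c b]! into [c a]
    times the same product for the shorter word, and the [c a] add up to n. *)

Lemma card_tuple_count (A : finType) (n : nat) (c : A -> nat) :
  (\sum_a c a = n ->
   #|[set s : n.-tuple A | [forall a, count_mem a s == c a]]|
     * \prod_a (c a)`! = n`!)%N.
Proof.
elim: n c => [|n IHn] c sum_c.
  have c0 a : c a = 0%N by move/eqP: sum_c; rewrite sum_nat_eq0 => /forallP/(_ a)/eqP.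
  rewrite big1 => [|a _]; last by rewrite c0.
  rewrite muln1 (_ : [set _ | _] = setT) ?cardsT ?card_tuple //.
  by apply/setP => s; rewrite !inE tuple0; apply/forallP => a; rewrite c0.
(* [S a] collects the tails of the words that start with [a]. *)
pose S a := [set s : n.-tuple A | [forall b, ((a == b) + count_mem b s == c b)%N]].
have -> : #|[set s : n.+1.-tuple A | [forall b, count_mem b s == c b]]|
          = (\sum_a #|S a|)%N.
  rewrite -sum1_card.
  rewrite (reindex (fun u : A * n.-tuple A => cons_tuple u.1 u.2)) /=; last first.
    exists (fun s => (thead s, [tuple of behead s])) => [[a s] _ | s _] /=.
      by congr pair; apply: val_inj.
    by case/tupleP: s => a s; apply: val_inj.
  transitivity (\sum_(u : A * n.-tuple A | u.2 \in S u.1) 1)%N.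
    by apply: eq_bigl => u; rewrite !inE.
  rewrite -(pair_big_dep xpredT (fun a s => s \in S a) (fun _ _ => 1%N)) /=.
  by apply: eq_bigr => a _; rewrite sum1_card.
(* Writing [n.+1] as the sum of the [c a] splits the identity by first letter: each [a] has to
   contribute [c a * n!]. *)
rewrite big_distrl /= factS -sum_c big_distrl /=; apply: eq_bigr => a _.
have [ca0 | ca_gt0] := posnP (c a).
  rewrite ca0 mul0n (_ : S a = set0) ?cards0 //.
  by apply/setP => s; rewrite !inE; apply/forallP => /(_ a); rewrite eqxx ca0.
(* Letter counts of the tail; the truncated subtraction is exact because [c a] is positive. *)
pose c' b := (c b - (a == b))%N.
have cE b : c b = ((a == b) + c' b)%N.
  by rewrite subnKC //; case: eqP => [<-|].
have sum_c' : (\sum_b c' b = n)%N.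
  apply: succn_inj; rewrite -sum_c (eq_bigr _ (fun b _ => cE b)) big_split /=.
  by rewrite [in RHS](bigD1 a) //= eqxx [in RHS]big1 // => b; rewrite eq_sym => /negPf->.
rewrite -(IHn _ sum_c') (_ : S a = [set s : n.-tuple A | [forall b, count_mem b s == c' b]]).
  rewrite (bigD1 a) //= [in RHS](bigD1 a) //= (cE a) eqxx add1n factS.
  rewrite (eq_bigr (fun b => (c' b)`!)) => [|b]; last first.
    by rewrite eq_sym (cE b) => /negPf->.
  by rewrite -mulnA mulnCA.
apply/setP => s; rewrite !inE; apply: eq_forallb => b.
by rewrite (cE b) eqn_add2l.
Qed.

Lemma card_lperms (m lam : nat) : (#|lperms m lam| * lam`! ^ m = (m * lam)`!)%N.
Proof.
have /card_tuple_count <- : (\sum_(a < m) lam = m * lam)%N.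
  by rewrite sum_nat_const card_ord.
by rewrite prod_nat_const card_ord.
Qed.

Lemma hammingC (T : eqType) (n : nat) (s t : n.-tuple T) : hamming s t = hamming t s.
Proof. by apply: eq_card => i; rewrite !inE eq_sym. Qed.

(** Where [s] and [u] differ, [t] cannot agree with both. *)
Lemma hamming_triangle (T : eqType) (n : nat) (t s u : n.-tuple T) :
  (hamming s u <= hamming s t + hamming t u)%N.
Proof.
apply: leq_trans (leq_card_setU _ _); apply/subset_leq_card/subsetP => i.
by rewrite !inE -negb_and; apply: contra => /andP[/eqP-> /eqP->].
Qed.

Lemma hammingss (T : eqType) (n : nat) (s : n.-tuple T) : hamming s s = 0%N.
Proof. by apply: eq_card0 => i; rewrite !inE eqxx. Qed.

Lemma sphere_size_gt0 (m lam r : nat) : (0 < sphere_size m lam r)%N.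
Proof.
by apply/card_gt0P; exists (base m lam); rewrite inE base_lperm hammingss.
Qed.

(** The empty code is admissible, so the maximum ranges over a nonempty family and is not the
    default value 0. *)
Lemma maxFPA_attained (m lam d : nat) :
  exists2 T : {set word m lam}, is_FPA d T & maxFPA m lam d = #|T|.
Proof.
have FPA0 : is_FPA d (set0 : {set word m lam}).
  by rewrite /is_FPA sub0set; apply/forall_inP => s; rewrite inE.
rewrite /maxFPA (bigop.bigmax_eq_arg set0) //.
by case: arg_maxnP => // T FPA_T _; exists T.
Qed.

Lemma FPA_setU1 (m lam d : nat) (T : {set word m lam}) (s : word m lam) :
    is_FPA d T -> s \in lperms m lam ->
    (forall t, t \in T -> (d <= hamming t s)%N) ->
  is_FPA d (s |: T).
Proof.
case/andP=> subT /forall_inP dT ls far_s; rewrite /is_FPA subUset sub1set ls subT.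
apply/forall_inP => u /setU1P[->|uT]; apply/forall_inP => v /setU1P[->|vT].
- by rewrite eqxx.
- by rewrite hammingC far_s ?implybT.
- by rewrite far_s ?implybT.
- by move/forall_inP: (dT u uT) => /(_ v vT).
Qed.

Lemma gilbert_varshamov (m lam d : nat) : (0 < d)%N ->
  (#|lperms m lam| <= maxFPA m lam d * sphere_size m lam (d - 1))%N.
Proof.
move=> d_gt0; have [T FPA_T maxT] := maxFPA_attained m lam d.
have /subsetP subT : T \subset lperms m lam by case/andP: FPA_T.
rewrite maxT -sum_nat_const.
rewrite -(eq_bigr _ (fun s sT => card_sphere (d - 1) (subT s sT))).
have cover_le : (#|\bigcup_(s in T) sphere (d - 1) s| <= \sum_(s in T) #|sphere (d - 1) s|)%N.
  elim/big_rec2: _ => [|s k A _ leA]; first by rewrite cards0.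
  by apply: leq_trans (leq_card_setU _ _) _; rewrite leq_add2l.
apply: leq_trans cover_le; apply/subset_leq_card/subsetP => s ls.
(* A word [s] outside every sphere is at distance at least [d] from all of [T]. *)
apply: contraT => /bigcupP far_s.
have {}far_s t : t \in T -> (d <= hamming t s)%N.
  move=> tT; rewrite leqNgt; apply/negP => lt_ts; apply: far_s; exists t => //.
  by rewrite inE ls -ltnS subn1 prednK.
(* Maximality of [T] forces [s] into [T], but then its distance 0 to itself would be at least
   [d]. *)
have : (#|s |: T| <= #|T|)%N.
  by rewrite -maxT; apply: leq_bigmax_cond; apply: FPA_setU1.
rewrite cardsU1; case: (boolP (s \in T)) => [/far_s|_]; last by rewrite ltnn.
by rewrite hammingss leqNgt d_gt0.
Qed.

Lemma sphere_packing (m lam d : nat) : (0 < d)%N ->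
  (maxFPA m lam d * sphere_size m lam ((d - 1) %/ 2) <= #|lperms m lam|)%N.
Proof.
move=> d_gt0; have [T /andP[/subsetP subT /forall_inP dT] ->] := maxFPA_attained m lam d.
set r := ((d - 1) %/ 2)%N.
have r2_lt : (r + r < d)%N.
  by rewrite addnn -muln2 -(prednK d_gt0) ltnS -subn1 leq_divM.
rewrite -sum_nat_const -(eq_bigr _ (fun s sT => card_sphere r (subT s sT))).
(* Disjointness by double counting: the pairs of a codeword and a point of its sphere are summed by
   point, and each point lies in at most one sphere. *)
under eq_bigr => s _ do rewrite -sum1_card.
rewrite (exchange_big_dep (fun t => t \in lperms m lam)) /=; last first.
  by move=> s t _; rewrite inE => /andP[].
rewrite -sum1_card; apply: leq_sum => t _; rewrite sum1_card.
apply/card_le1_eqP => v u /andP[vT +] /andP[uT +].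
rewrite !inE => /andP[_ vt] /andP[_ ut].
(* Distinct codewords [u] and [v] sharing the point [t] would be at distance at most [r + r], hence
   below [d]. *)
apply/eqP; move/forall_inP: (dT u uT) => /(_ v vT); apply: contraTT => neq_uv.
rewrite neq_uv -ltnNge; apply: leq_ltn_trans r2_lt.
by apply: leq_trans (hamming_triangle t u v) (leq_add ut _); rewrite hammingC.
Qed.

Theorem theorem2p7 (m lam n d : nat)
    (hm : (0 < m)%N) (hlam : (0 < lam)%N) (hn : n = (m * lam)%N) (hd : (0 < d)%N) :
  (n`!)%:R / ((lam`!)%:R ^+ m * (sphere_size m lam (d - 1))%:R)
     <= (maxFPA m lam d)%:R :> rat
  /\
  (maxFPA m lam d)%:R
     <= (n`!)%:R / ((lam`!)%:R ^+ m * (sphere_size m lam ((d - 1) %/ 2))%:R) :> rat.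
Proof.
have pos r : 0 < (lam`!)%:R ^+ m * (sphere_size m lam r)%:R :> rat.
  by rewrite mulr_gt0 ?exprn_gt0 ?ltr0n ?fact_gt0 ?sphere_size_gt0.
(* With the positive denominators cleared, both bounds become inequalities in [nat], from which the
   factor [lam! ^ m] cancels. *)
rewrite ler_pdivrMr ?ler_pdivlMr //.
rewrite -natrX -!natrM !ler_nat hn -card_lperms ![(_ ^ m * _)%N]mulnC !mulnA.
by rewrite !leq_pmul2r ?expn_gt0 ?fact_gt0 // gilbert_varshamov ?sphere_packing.
Qed.
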